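(* Let $n\ge 1$, $m=n(n+1)/2$, and let $\phi:\mathbb{R}^{n\times n}\to\mathbb{R}$ be Fréchet differentiable, with gradient $G:=\nabla\phi$ (with respect to the Frobenius inner product). Let $\phi_{sym}:=\phi|_{\mathbb{S}^{n\times n}}:\mathbb{S}^{n\times n}\to\mathbb{R}$ be the restriction of $\phi$ to the symmetric matrices, so that $\nabla\phi_{sym}=\mathrm{sym}(G)$ is the gradient of $\phi_{sym}$ in $\mathbb{S}^{n\times n}$. Then: 1. $\phi_{sym}$ can be identified with the scalar function $\phi_s:\mathbb{R}^m\to\mathbb{R}$ given by $\phi_s=\phi_{sym}\circ\mathrm{mat}\circ D$, i.e. $\phi_s(\mathrm{vech}(A))=\phi_{sym}(A)$ for all $A\in\mathbb{S}^{n\times n}$. 2. Let $\nabla\phi_s$ be the gradient of $\phi_s$ with respect to the Euclidean inner product on $\mathbb{R}^m$. For $A\in\mathbb{S}^{n\times n}$ define the symmetric matrix $$G_s(A)=\mathrm{mat}\big(D(D^TD)^{-1}\,\nabla\phi_s(\mathrm{vech}(A))\big)\in\mathbb{S}^{n\times n}.$$ Then for every $A\in\mathbb{S}^{n\times n}$ and every $H\in\mathbb{S}^{n\times n}$, $$\langle G_s(A),H\rangle_F=\langle\nabla\phi_s(\mathrm{vech}(A)),\mathrm{vech}(H)\rangle_{\mathbb{R}^m}=\langle\mathrm{sym}(G(A)),H\rangle_F .$$ Consequently $G_s(A)=\mathrm{sym}(G(A))$ for every $A\in\mathbb{S}^{n\times n}$.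
   Context: $\mathbb{S}^{n\times n}$ is the subspace of symmetric matrices in $\mathbb{R}^{n\times n}$. $\langle A,B\rangle_F:=\mathrm{tr}(A^TB)$ is the Frobenius inner product on $\mathbb{R}^{n\times n}$ (and on $\mathbb{S}^{n\times n}$ by restriction), and $\langle\cdot,\cdot\rangle_{\mathbb{R}^m}$ is the Euclidean inner product. $\mathrm{sym}(A):=(A+A^T)/2$. Gradients: for a real-valued Fréchet differentiable function $f$ on a finite-dimensional real inner product space $V$, the gradient $\nabla f(A)\in V$ is the unique element with $\langle\nabla f(A),H\rangle=\mathcal{D}f(A)[H]$ for all $H\in V$, where $\mathcal{D}f(A)$ is the Fréchet derivative at $A$. This is used with $V=\mathbb{R}^{n\times n}$ or $V=\mathbb{S}^{n\times n}$ (Frobenius inner product) and $V=\mathbb{R}^m$ (Euclidean inner product). Operators: $\mathrm{vec}:\mathbb{R}^{n\times n}\to\mathbb{R}^{n^2}$ stacks the columns of a matrix, and $\mathrm{mat}:\mathbb{R}^{n^2}\to\mathbb{R}^{n\times n}$ is its inverse. Let $\mathcal{V}=\mathrm{vec}(\mathbb{S}^{n\times n})$. The elimination operator $P:\mathcal{V}\to\mathbb{R}^m$ removes the redundant entries of $\mathrm{vec}(A)$, $A$ symmetric, keeping exactly the entries $A_{ij}$ with $i\ge j$ (in column order). $\mathrm{vech}(A):=P\,\mathrm{vec}(A)\in\mathbb{R}^m$ for $A\in\mathbb{S}^{n\times n}$. The duplication operator $D:\mathbb{R}^m\to\mathcal{V}\subset\mathbb{R}^{n^2}$ is the linear map (an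 $n^2\times m$ matrix) determined by $\mathrm{vec}(A)=D\,\mathrm{vech}(A)$ for all $A\in\mathbb{S}^{n\times n}$. $D^T$ is its transpose as an $n^2\times m$ matrix; $D$ is injective, so $D^TD$ is invertible. *)

(* Defs.v *)
From HB Require Import structures.
From mathcomp Require Import all_boot all_order all_algebra.
From mathcomp Require Import all_classical all_reals all_analysis.
From mathcomp Require Import zify ring.
Set Implicit Arguments.
Unset Strict Implicit.
Unset Printing Implicit Defensive.
Import Order.TTheory GRing.Theory Num.Theory.
Import numFieldNormedType.Exports.
Local Open Scope ring_scope.

Section Gradient.
Context {R : realType}.

Definition frobenius n (A B : 'M[R]_n) : R := \tr (A^T *m B).

Definition euclidean m (x y : 'cV[R]_m) : R := \sum_(i < m) x i 0 * y i 0.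

Definition is_gradient (V : normedModType R) (ip : V -> V -> R) (f : V -> R)
    (A g : V) : Prop :=
  forall H : V, ip g H = 'd f A H.

(* Only meaningful for [f] differentiable at [A], since ['d f A] is a default
   linear map otherwise.  Existence and uniqueness for the three inner products
   used here: [frobenius_gradientP], [symfrobenius_gradientP] and
   [euclidean_gradientP]. *)
Definition gradient (V : normedModType R) (ip : V -> V -> R) (f : V -> R)
    (A : V) : V :=
  xget 0 [set g | is_gradient ip f A g]%classic.

End Gradient.

Section SymmetricSpace.
Context {R : realType} {n : nat}.

Definition symmetric_pred : {pred 'M[R]_n} := fun A => A \is symmetricmx.

Lemma symmetric_predE (A : 'M[R]_n) : (A \in symmetric_pred) = (A == A^T).
Proof.
by rewrite -[LHS]/(A \is symmetricmx) is_hermitianmxE expr0 scale1r map_mx_id.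
Qed.

Lemma symmetric_pred_submod : submod_closed symmetric_pred.
Proof.
split=> [|a A B]; rewrite !symmetric_predE ?trmx0 //.
move=> /eqP hA /eqP hB; rewrite linearD linearZ /=.
by rewrite -hA -hB.
Qed.

HB.instance Definition _ := GRing.isSubmodClosed.Build R 'M[R]_n
  symmetric_pred symmetric_pred_submod.

Record symmat := SymMat {
  symmat_val :> 'M[R]_n;
  _ : symmat_val \in symmetric_pred }.

HB.instance Definition _ := [isSub for symmat_val].
HB.instance Definition _ := [Choice of symmat by <:].
HB.instance Definition _ := [SubChoice_isSubLmodule of symmat by <:].

Lemma symmat_normD (A B : symmat) : `|val (A + B)| <= `|val A| + `|val B|.
Proof. by rewrite raddfD ler_normD. Qed.

Lemma symmat_normZ (l : R) (A : symmat) : `|val (l *: A)| = `|l| * `|val A|.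
Proof. by rewrite linearZ normrZ. Qed.

Lemma symmat_norm0_eq0 (A : symmat) : `|val A| = 0 -> A = 0.
Proof.
by move=> /eqP; rewrite normr_eq0 => /eqP A0; apply/val_inj; rewrite raddf0.
Qed.

(* The norm induced from 'M[R]_n, which is the entrywise maximum; Fréchet
   derivatives do not depend on the norm in finite dimension. *)
HB.instance Definition _ := @Lmodule_isNormed.Build R symmat
  (fun A => `|val A|) symmat_normD symmat_normZ symmat_norm0_eq0.

Definition symfrobenius (A B : symmat) : R := frobenius A B.

Lemma symmat_tr (A : symmat) : (A : 'M[R]_n)^T = A.
Proof. by apply/esym/eqP; rewrite -symmetric_predE; exact: (valP A). Qed.

Lemma symmatC (A : symmat) i j : (A : 'M[R]_n) i j = (A : 'M[R]_n) j i.
Proof. by rewrite -[in LHS]symmat_tr mxE. Qed.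

Lemma sym_subproof (A : 'M[R]_n) : 2^-1 *: (A + A^T) \in symmetric_pred.
Proof.
by rewrite symmetric_predE; apply/eqP/matrixP => i j; rewrite !mxE addrC.
Qed.

Definition sym (A : 'M[R]_n) : symmat := SymMat (sym_subproof A).

Lemma sym_is_linear : linear sym.
Proof.
move=> a A B; apply/val_inj; rewrite [RHS]linearP /=.
apply/matrixP => i j; rewrite !mxE; ring.
Qed.

HB.instance Definition _ := GRing.isLinear.Build R 'M[R]_n symmat *:%R sym
  sym_is_linear.

Lemma sym_id (A : symmat) : sym A = A.
Proof.
apply/val_inj/matrixP => i j; rewrite /= symmat_tr !mxE; by field.
Qed.

End SymmetricSpace.

Arguments symmat : clear implicits.

Section Vectorization.
Context {R : realType} {n : nat}.

(* [mxvec] is row-major, so the columns of A are stacked by [mxvec A^T]. *)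
Definition vec (A : 'M[R]_n) : 'cV[R]_(n * n) := (mxvec A^T)^T.

Definition mat (v : 'cV[R]_(n * n)) : 'M[R]_n := (vec_mx v^T)^T.

Lemma vecK : cancel vec mat.
Proof. by move=> A; rewrite /vec /mat trmxK mxvecK trmxK. Qed.

Lemma matK : cancel mat vec.
Proof. by move=> v; rewrite /vec /mat trmxK vec_mxK trmxK. Qed.

Lemma vecE A (i j : 'I_n) : vec A (mxvec_index j i) 0 = A i j.
Proof. by rewrite /vec mxE mxvecE mxE. Qed.

Lemma matE v (i j : 'I_n) : mat v i j = v (mxvec_index j i) 0.
Proof. by rewrite -vecE matK. Qed.

End Vectorization.

Definition half_dim (n : nat) : nat := (n * n.+1) %/ 2.

(* Positions in [vec A] of the entries A i j with i >= j, where
   p = (j, i) is the pair (column, row). *)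
Definition lower_index (n : nat) : {set 'I_(n * n)} :=
  [set mxvec_index p.1 p.2 | p in [pred p : 'I_n * 'I_n | (p.1 <= p.2)%N]].

Lemma mxvec_index_inj n (p q : 'I_n * 'I_n) :
  mxvec_index p.1 p.2 = mxvec_index q.1 q.2 -> p = q.
Proof.
by move=> /cast_ord_inj /enum_rank_inj; case: p q => [? ?] [? ?].
Qed.

Lemma card_lower_index n : #|lower_index n| = half_dim n.
Proof.
rewrite card_imset; last exact: mxvec_index_inj.
rewrite -sum1_card.
rewrite -(pair_big_dep xpredT (fun i j : 'I_n => (i <= j)%N) (fun _ _ => 1%N)).
rewrite /= (exchange_big_dep xpredT) //=.
transitivity (\sum_(j < n) j.+1)%N.
  apply: eq_bigr => j _.
  by rewrite -(big_ord_widen _ (fun=> 1%N) (ltn_ord j)) sum1_card card_ord.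
rewrite /half_dim; elim: n => [|k IH]; first by rewrite big_ord0.
by rewrite big_ord_recr /= IH; nia.
Qed.

Section HalfVectorization.
Context {R : realType} {n : nat}.

(* The k-th position of [lower_index]: [enum_val] lists them in increasing
   order, i.e. column by column. *)
Definition lower_val (k : 'I_(half_dim n)) : 'I_(n * n) :=
  enum_val (cast_ord (esym (card_lower_index n)) k).

(* P, written on all of R^(n^2); only its values on vec(S) matter. *)
Definition elimination (v : 'cV[R]_(n * n)) : 'cV[R]_(half_dim n) :=
  \col_k v (lower_val k) 0.

Definition vech (A : symmat R n) : 'cV[R]_(half_dim n) := elimination (vec A).

(* D, the unique matrix with vec(A) = D vech(A) for A symmetric; see
   [duplicationP] and [duplication_unique]. *)
Definition duplication : 'M[R]_(n * n, half_dim n) :=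
  xget 0 [set D | forall A : symmat R n, vec A = D *m vech A]%classic.

Let lo (j i : 'I_n) : 'I_(n * n) :=
  if (j <= i)%N then mxvec_index j i else mxvec_index i j.

Let D0 : 'M[R]_(n * n, half_dim n) :=
  \matrix_(l, k) vec (\matrix_(i, j) (lower_val k == lo j i)%:R) l 0.

Let loC i j : lo i j = lo j i.
Proof. by rewrite /lo; case: ltngtP => // /val_inj ->. Qed.

Let D0E (i j : 'I_n) k : D0 (mxvec_index j i) k = (lower_val k == lo j i)%:R.
Proof. by rewrite mxE vecE mxE. Qed.

Let lower_val_inj : injective lower_val.
Proof. by move=> k l /enum_val_inj /cast_ord_inj. Qed.

Let lower_valP k : exists2 p : 'I_n * 'I_n,
  (p.1 <= p.2)%N & lower_val k = mxvec_index p.1 p.2.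
Proof.
have: lower_val k \in lower_index n by exact: enum_valP.
by case/imsetP => p hp ->; exists p.
Qed.

Let lower_val_surj (i j : 'I_n) : (j <= i)%N ->
  exists k, lower_val k = mxvec_index j i.
Proof.
move=> hji.
have h : mxvec_index j i \in lower_index n.
  by apply/imsetP; exists (j, i).
exists (cast_ord (card_lower_index n) (enum_rank_in h (mxvec_index j i))).
by rewrite /lower_val cast_ordK enum_rankK_in.
Qed.

Let lo_surj (j i : 'I_n) : exists k, lower_val k = lo j i.
Proof.
rewrite /lo; case: (leqP j i) => h; first exact: lower_val_surj.
by apply: lower_val_surj; exact: ltnW.
Qed.

Let D0_mulE (x : 'cV[R]_(half_dim n)) (i j : 'I_n) k : lower_val k = lo j i ->
  (D0 *m x) (mxvec_index j i) 0 = x k 0.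
Proof.
move=> hk; rewrite mxE (bigD1 k) //= D0E hk eqxx mul1r big1 ?addr0 // => l lk.
by rewrite D0E -hk (inj_eq lower_val_inj) (negPf lk) mul0r.
Qed.

Let D0P (A : symmat R n) : vec A = D0 *m vech A.
Proof.
apply/colP => l; case/mxvec_indexP: l => j i.
have [k hk] := lo_surj j i.
rewrite (D0_mulE _ hk) vecE mxE hk /lo.
by case: ifP => _; rewrite vecE // symmatC.
Qed.

Let D0_sym (x : 'cV[R]_(half_dim n)) : mat (D0 *m x) \in symmetric_pred.
Proof.
rewrite symmetric_predE; apply/eqP/matrixP => i j; rewrite [RHS]mxE !matE.
have [k hk] := lo_surj j i; rewrite (D0_mulE _ hk).
by rewrite (@D0_mulE _ _ _ k) // loC.
Qed.

Let vech_D0 (x : 'cV[R]_(half_dim n)) : vech (SymMat (D0_sym x)) = x.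
Proof.
apply/colP => k; rewrite mxE /= matK.
have [[j i] /= hji hk] := lower_valP k.
by rewrite hk (@D0_mulE _ _ _ k) // hk /lo hji.
Qed.

Lemma duplication_unique (X Y : 'M[R]_(n * n, half_dim n)) :
    (forall A : symmat R n, vec A = X *m vech A) ->
    (forall A : symmat R n, vec A = Y *m vech A) -> X = Y.
Proof.
move=> hX hY; apply/matrixP => l k.
have h (Z : 'M[R]_(n * n, half_dim n)) : Z l k = (Z *m delta_mx k (0 : 'I_1)) l 0.
  by rewrite -colE mxE.
rewrite (h X) (h Y) -[delta_mx k 0]vech_D0.
by rewrite -hX -hY.
Qed.

Lemma duplicationP (A : symmat R n) : vec A = duplication *m vech A.
Proof.
have : exists D : 'M[R]_(n * n, half_dim n), forall A : symmat R n, vec A = D *m vech A.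
  by exists D0.
by move/(@xgetPex _ 0); apply.
Qed.

Lemma duplication_sym (x : 'cV[R]_(half_dim n)) :
  mat (duplication *m x) \in symmetric_pred.
Proof. by rewrite (duplication_unique duplicationP D0P). Qed.

(* mat o D, as a map from R^m to S *)
Definition unvech (x : 'cV[R]_(half_dim n)) : symmat R n :=
  SymMat (duplication_sym x).

Lemma vechK : cancel vech unvech.
Proof. by move=> A; apply/val_inj; rewrite /= -duplicationP vecK. Qed.

Lemma unvechK : cancel unvech vech.
Proof.
move=> x; rewrite -[RHS]vech_D0; congr vech; apply/val_inj => /=.
by rewrite (duplication_unique duplicationP D0P).
Qed.

Lemma duplication_gram_unit : duplication^T *m duplication \in @unitmx R (half_dim n).
Proof.
rewrite -row_free_unit -kermx_eq0; apply/eqP/row_matrixP => i; rewrite row0.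
set u := row i _.
have hu : u *m (duplication^T *m duplication) = 0.
  by apply/sub_kermxP; exact: row_sub.
have h0 : duplication *m u^T = 0.
  have h : \sum_l (duplication *m u^T) l 0 ^+ 2 = 0.
    transitivity ((u *m (duplication^T *m duplication) *m u^T) 0 0).
      have -> : u *m (duplication^T *m duplication) *m u^T
          = (duplication *m u^T)^T *m (duplication *m u^T).
        by rewrite trmx_mul trmxK !mulmxA.
      by rewrite mxE; apply: eq_bigr => l _; rewrite [X in X * _]mxE expr2.
    by rewrite hu mul0mx mxE.
  apply/colP => l; rewrite [RHS]mxE.
  move/eqP: h; rewrite psumr_eq0; last by move=> ? _; exact: sqr_ge0.
  by move/allP/(_ l (mem_index_enum _)); rewrite sqrf_eq0 => /eqP.
apply: trmx_inj; rewrite trmx0 -[u^T]unvechK.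
have -> : unvech u^T = 0.
  by apply/val_inj; rewrite /= h0 /mat trmx0 linear0 trmx0.
apply/colP => k; rewrite [LHS]mxE [RHS]mxE.
case/mxvec_indexP: (lower_val k) => r s; rewrite vecE.
by rewrite -[symmat_val 0]/(val (0 : symmat R n)) raddf0 mxE.
Qed.

End HalfVectorization.

Section GradientExistence.
Context {R : realType}.

Lemma frobeniusE n (A B : 'M[R]_n) : frobenius A B = \sum_i \sum_j A i j * B i j.
Proof.
rewrite /frobenius /mxtrace exchange_big; apply: eq_bigr => j _.
by rewrite mxE; apply: eq_bigr => i _; rewrite mxE.
Qed.

Lemma frobenius_gradientP n (f : 'M[R]_n -> R) (A g : 'M[R]_n) :
  is_gradient (@frobenius R n) f A g <-> g = gradient (@frobenius R n) f A.
Proof.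
have ex : exists g, is_gradient (@frobenius R n) f A g.
  exists (\matrix_(i, j) 'd f A (delta_mx i j)) => H.
  rewrite frobeniusE [in RHS](matrix_sum_delta H) linear_sum.
  apply: eq_bigr => i _; rewrite linear_sum; apply: eq_bigr => j _.
  by rewrite mxE linearZ /= mulrC.
have gP : is_gradient (@frobenius R n) f A (gradient (@frobenius R n) f A).
  exact: xgetPex.
split=> [gA|->//]; apply/matrixP => i j.
have h (B : 'M[R]_n) : frobenius B (delta_mx i j) = B i j.
  rewrite frobeniusE (bigD1 i) //= (bigD1 j) //= mxE !eqxx mulr1.
  rewrite big1 ?addr0 => [|l /negPf lj]; last by rewrite mxE lj andbF mulr0.
  rewrite big1 ?addr0 // => k /negPf ki; rewrite big1 // => l _.
  by rewrite mxE ki mulr0.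
by rewrite -[LHS]h -[RHS]h gA gP.
Qed.

Lemma euclidean_gradientP m (f : 'cV[R]_m -> R) (x g : 'cV[R]_m) :
  is_gradient (@euclidean R m) f x g <-> g = gradient (@euclidean R m) f x.
Proof.
have ex : exists g, is_gradient (@euclidean R m) f x g.
  exists (\col_i 'd f x (delta_mx i 0)) => H.
  rewrite /euclidean [in RHS](matrix_sum_delta H) linear_sum.
  by apply: eq_bigr => i _; rewrite big_ord1 mxE linearZ /= mulrC.
have gP : is_gradient (@euclidean R m) f x (gradient (@euclidean R m) f x).
  exact: xgetPex.
split=> [gx|->//]; apply/colP => i.
have h (y : 'cV[R]_m) : euclidean y (delta_mx i 0) = y i 0.
  rewrite /euclidean (bigD1 i) //= mxE !eqxx mulr1 big1 ?addr0 // => k /negPf ki.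
  by rewrite mxE ki mulr0.
by rewrite -[LHS]h -[RHS]h gx gP.
Qed.

Lemma frobeniusC n (A B : 'M[R]_n) : frobenius A B = frobenius B A.
Proof. by rewrite /frobenius -mxtrace_tr trmx_mul trmxK. Qed.

Lemma frobenius_sym n (A : 'M[R]_n) (H : symmat R n) :
  frobenius (sym A) H = frobenius A H.
Proof.
rewrite /frobenius /=.
have -> : (2^-1 *: (A + A^T))^T = 2^-1 *: (A^T + A).
  by apply/matrixP => i j; rewrite !mxE.
rewrite -scalemxAl mxtraceZ mulmxDl mxtraceD.
have -> : \tr (A *m H) = \tr (A^T *m H).
  by rewrite -mxtrace_tr trmx_mul symmat_tr mxtrace_mulC.
by field.
Qed.

Lemma symfrobenius_gradientP n (f : symmat R n -> R) (A g : symmat R n) :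
  is_gradient symfrobenius f A g <-> g = gradient symfrobenius f A.
Proof.
have ex : exists g, is_gradient symfrobenius f A g.
  exists (sym (\matrix_(i, j) 'd f A (sym (delta_mx i j)))) => H.
  rewrite /symfrobenius frobenius_sym frobeniusE.
  rewrite -[in RHS](sym_id H) [in RHS](matrix_sum_delta (val H)) !linear_sum.
  apply: eq_bigr => i _; rewrite !linear_sum; apply: eq_bigr => j _.
  by rewrite mxE !linearZ /= mulrC.
have gP : is_gradient symfrobenius f A (gradient symfrobenius f A).
  exact: xgetPex.
split=> [gA|->//]; apply/val_inj/matrixP => i j.
have h (B : symmat R n) : symfrobenius B (sym (delta_mx i j)) = val B i j.
  rewrite /symfrobenius frobeniusC frobenius_sym frobeniusC frobeniusE.
  rewrite (bigD1 i) //= (bigD1 j) //= mxE !eqxx mulr1.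
  rewrite big1 ?addr0 => [|l /negPf lj]; last by rewrite mxE lj andbF mulr0.
  rewrite big1 ?addr0 // => k /negPf ki; rewrite big1 // => l _.
  by rewrite mxE ki mulr0.
by rewrite -[LHS]h -[RHS]h gA gP.
Qed.

End GradientExistence.

(* Main.v *)
Require Import Defs.
From HB Require Import structures.
From mathcomp Require Import all_boot all_order all_algebra.
From mathcomp Require Import all_classical all_reals all_analysis.
Set Implicit Arguments.
Unset Strict Implicit.
Unset Printing Implicit Defensive.
Import Order.TTheory GRing.Theory Num.Theory.
Import numFieldNormedType.Exports.
Local Open Scope ring_scope.

(** The three functions differ by two linear changes of variable:
    phi_sym = phi o val, with val the inclusion of the symmetric matrices, and
    phi_s = phi_sym o unvech.  Both maps are linear and continuous
    ([symmat_val_continuous], [linear_mx_continuous]), hence equal to their own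
    derivatives, so the chain rule gives, for symmetric A and H,
      d phi_s (vech A) [vech H] = d phi_sym A [H] = d phi A [H]
        = <G(A), H> = <sym (G(A)), H>,
    the last equality because a symmetric H does not see the antisymmetric part
    of G(A).  Hence sym (G(A)) is the gradient of phi_sym, and the Euclidean
    gradient g of phi_s at vech A satisfies <g, vech H> = <sym (G(A)), H>.

    It remains to turn the Euclidean product on half-vectorizations into a
    Frobenius product of matrices.  As vec H = D vech H, the Frobenius product
    of symmetric matrices pulls back through vech to the form x^T (D^T D) y,
    and the factor (D^T D)^-1 in G_s cancels exactly this Gram matrix
    ([frobenius_unvech_gram]).  So G_s(A) represents the same linear form on
    symmetric matrices as sym (G(A)), and uniqueness of the gradient of phi_sym
    makes them equal. *)

(** A linear map out of a matrix space is a finite combination of the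
    coordinate functions, each of which is continuous. *)
Lemma linear_mx_continuous (R : realType) p q (V : normedModType R)
    (f : {linear 'M[R]_(p, q) -> V}) : continuous f.
Proof.
have -> : f = (fun M => \sum_i \sum_j M i j *: f (delta_mx i j)) :> (_ -> _).
  apply/funext => M; rewrite [in LHS](matrix_sum_delta M) linear_sum.
  apply: eq_bigr => i _; rewrite linear_sum.
  by apply: eq_bigr => j _; rewrite linearZ.
apply: continuous_big => [|i _]; first exact: add_continuous.
apply: continuous_big => [|j _ M]; first exact: add_continuous.
by apply: (@cvgZr_tmp R V _ (nbhs M)); exact: coord_continuous.
Qed.

(** The norm of symmetric matrices is the restriction of the norm of all
    matrices, so the inclusion is bounded by 1. *)
Lemma symmat_val_continuous (R : realType) n :
  continuous (\val : symmat R n -> 'M[R]_n).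
Proof.
apply: bounded_linear_continuous.
apply/linear_boundedP; near=> r => A.
by rewrite ler_peMl //; near: r; exact: nbhs_pinfty_ge.
Unshelve. all: by end_near. Qed.

Lemma unvech_is_linear (R : realType) n : linear (@unvech R n).
Proof.
move=> a x y; apply/val_inj; rewrite [RHS]linearP /=.
by rewrite linearP /mat !linearP.
Qed.

HB.instance Definition _ (R : realType) n := GRing.isLinear.Build R
  'cV[R]_(half_dim n) (symmat R n) *:%R (@unvech R n) (@unvech_is_linear R n).

Lemma frobenius_vec (R : realType) n (A B : 'M[R]_n) :
  frobenius A B = euclidean (vec A) (vec B).
Proof.
rewrite frobeniusE exchange_big pair_bigA /euclidean /=.
rewrite (reindex _ (curry_mxvec_bij _ _)) /=.
by apply: eq_bigr => -[j i] _; rewrite /= !vecE.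
Qed.

Lemma euclidean_mulmx (R : realType) m (x y : 'cV[R]_m) :
  euclidean x y = (x^T *m y) 0 0.
Proof. by rewrite mxE; apply: eq_bigr => i _; rewrite mxE. Qed.

(** With M = D^T D, which is symmetric, the left-hand side is
    (D M^-1 g)^T (D vech H) = g^T M^-1 M vech H.  The Gram matrix M measures how
    far vech is from an isometry, since it counts the off-diagonal entries
    twice. *)
Lemma frobenius_unvech_gram (R : realType) n (g : 'cV[R]_(half_dim n))
    (H : symmat R n) :
  frobenius (unvech (invmx (duplication^T *m duplication) *m g)) H
  = euclidean g (vech H).
Proof.
rewrite frobenius_vec !duplicationP unvechK !euclidean_mulmx.
set M := _^T *m duplication.
have MT : M^T = M by rewrite trmx_mul trmxK.
rewrite !trmx_mul trmx_inv MT -!mulmxA (mulmxA duplication^T).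
by rewrite mulKmx // duplication_gram_unit.
Qed.

Theorem theorem3p8 (R : realType) (n : nat) (n_ge1 : (1 <= n)%N)
    (phi : 'M[R]_n -> R) (dphi : forall A : 'M[R]_n, differentiable phi A) :
  let m := half_dim n in
  let D : 'M[R]_(n * n, m) := duplication in
  let G : 'M[R]_n -> 'M[R]_n := gradient (@frobenius R n) phi in
  let phi_sym : symmat R n -> R := fun A => phi A in
  let phi_s : 'cV[R]_m -> R := fun x => phi_sym (unvech x) in
  let grad_phi_s : 'cV[R]_m -> 'cV[R]_m := gradient (@euclidean R m) phi_s in
  let G_s : symmat R n -> symmat R n :=
    fun A => unvech (invmx (D^T *m D) *m grad_phi_s (vech A)) in
  [/\ (forall A : symmat R n, differentiable phi_sym A /\
         gradient (@symfrobenius R n) phi_sym A = sym (G A)),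
      (forall A : symmat R n, phi_s (vech A) = phi_sym A),
      (forall x : 'cV[R]_m, differentiable phi_s x),
      (forall A H : symmat R n,
         frobenius (G_s A) H = euclidean (grad_phi_s (vech A)) (vech H) /\
         euclidean (grad_phi_s (vech A)) (vech H) = frobenius (sym (G A)) H)
    & (forall A : symmat R n, G_s A = sym (G A))].
Proof.
move=> m D G phi_sym phi_s grad_phi_s G_s.
have GE (A H : 'M[R]_n) : frobenius (G A) H = 'd phi A H.
  by have /frobenius_gradientP := erefl (G A); apply.
have dval (A : symmat R n) : differentiable (\val : symmat R n -> 'M[R]_n) A.
  by apply: linear_differentiable; exact: symmat_val_continuous.
have dunvech x : differentiable (@unvech R n) x.
  by apply: linear_differentiable; exact: linear_mx_continuous.
have diff_val (A : symmat R n) :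
    'd (\val : symmat R n -> 'M[R]_n) A = \val :> (_ -> _).
  by apply: diff_lin; exact: symmat_val_continuous.
have diff_unvech x : 'd (@unvech R n) x = @unvech R n :> (_ -> _).
  by apply: diff_lin; exact: linear_mx_continuous.
have dphi_sym A : differentiable phi_sym A.
  exact: (differentiable_comp (dval A) (dphi _)).
have dphi_s x : differentiable phi_s x.
  exact: (differentiable_comp (dunvech x) (dphi_sym _)).
(* The chain rule through the inclusion tests the derivative of phi on symmetric
   directions only, and these pair with G A as with sym (G A). *)
have diff_phi_sym (A H : symmat R n) : 'd phi_sym A H = frobenius (sym (G A)) H.
  rewrite frobenius_sym GE.
  have -> : 'd phi_sym A = 'd phi (val A) \o 'd \val A :> (_ -> _).
    exact: (diff_comp (dval A) (dphi _)).
  by rewrite /= diff_val.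
have diff_phi_s (A H : symmat R n) :
    'd phi_s (vech A) (vech H) = 'd phi_sym A H.
  have -> : 'd phi_s (vech A)
      = 'd phi_sym (unvech (vech A)) \o 'd (@unvech R n) (vech A) :> (_ -> _).
    exact: (diff_comp (dunvech _) (dphi_sym _)).
  by rewrite /= diff_unvech !vechK.
have grad_sE (A H : symmat R n) :
    euclidean (grad_phi_s (vech A)) (vech H) = frobenius (sym (G A)) H.
  rewrite -diff_phi_sym -diff_phi_s.
  by have /euclidean_gradientP := erefl (grad_phi_s (vech A)); apply.
have G_sE (A H : symmat R n) :
    frobenius (G_s A) H = euclidean (grad_phi_s (vech A)) (vech H).
  exact: frobenius_unvech_gram.
have grad_symE (A : symmat R n) :
    sym (G A) = gradient (@symfrobenius R n) phi_sym A.
  by apply/symfrobenius_gradientP => H; rewrite diff_phi_sym.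
split=> [A|A|||A] //.
- by rewrite /phi_s vechK.
(* G_s A represents the derivative of phi_sym at A, as sym (G A) does. *)
- rewrite grad_symE; apply/symfrobenius_gradientP => H.
  by rewrite diff_phi_sym -grad_sE -G_sE.
Qed.
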